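(* Let $q>7$ be a safe prime power and fix $0<\delta<1/2$. Then there exists a subfamily $\mathcal{L}_{q,\delta}\subseteq\mathcal{L}_q$ with $|\mathcal{L}_{q,\delta}|\gg \delta\, q\log q$ whose maximal cross-correlation satisfies $C(\mathcal{L}_{q,\delta})=O\left(q^{1/2+\delta}\right)$, where the implied constants are absolute.
   Context: For a positive integer $n$, a Costas permutation of $\{1,\ldots,n\}$ is a permutation $f$ with $f(i+k)-f(i)\neq f(j+k)-f(j)$ for all integers $1\le k\le n-2$ and $1\le i<j\le n-k$. For maps $f_1,f_2:\{1,\ldots,n\}\to\{1,\ldots,n\}$ and integers $1-n\le u,v\le n-1$, the cross-correlation $C_{f_1,f_2}(u,v)$ is the number of $x\in\{\max\{1,1-u\},\ldots,\min\{n,n-u\}\}$ with $f_1(x)+v=f_2(x+u)$. For a family $\mathcal{F}$ of Costas permutations of $\{1,\ldots,n\}$, $n\ge2$, the maximal cross-correlation is $C(\mathcal{F})=\max_{1-n\le u,v\le n-1}\max_{f_1,f_2\in\mathcal{F},\,f_1\ne f_2}C_{f_1,f_2}(u,v)$. For a prime power $q>2$, let $\mathcal{U}_q$ be the set of primitive elements of the finite field $\mathbb{F}_q$. For $g_1,g_2\in\mathcal{U}_q$, the Golomb Costas permutation $\pi_{g_1,g_2}$ of $\{1,\ldots,q-2\}$ is defined by $\pi_{g_1,g_2}(x)=y$ if and only if $g_1^x+g_2^y=1$. Let $\mathcal{L}_q=\{\pi_{g_1,g_2}: g_1,g_2\in\mathcal{U}_q\}$ (a set of permutations of $\{1,\dots,q-2\}$,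 so $n=q-2$ above). A prime power $q$ is called a safe prime power if either $q$ is odd and $(q-1)/2$ is prime, or $q$ is even (a power of $2$) and $q-1$ is prime. The notation $F\gg G$ means $|G|\le cF$ for an absolute constant $c>0$. *)

(* Defs.v *)
From mathcomp Require Import all_boot all_order all_algebra all_field.
Set Implicit Arguments. Unset Strict Implicit. Unset Printing Implicit Defensive.
Import GRing.Theory.
Local Open Scope ring_scope.

(* A map {1,..,n} -> {1,..,n} is represented by f : {ffun 'I_n -> 'I_n},
   the ordinal i standing for the integer i+1 (both in domain and codomain). *)
Notation map_n n := {ffun 'I_n -> 'I_n}.

Definition ccorr n (f1 f2 : map_n n) (u v : int) : nat :=
  #|[set x : 'I_n | [exists y : 'I_n,
       ((y : nat)%:Z == (x : nat)%:Z + u)%R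
       && (((f1 x : nat)%:Z + v)%R == (f2 y : nat)%:Z)]]|.

Definition maxcc n (F : {set map_n n}) : nat :=
  \max_(f1 in F) \max_(f2 in F | f2 != f1)
    \max_(i < (2 * n).-1) \max_(j < (2 * n).-1)
      ccorr f1 f2 ((i : nat)%:Z - ((n : nat)%:Z - 1))%R
                  ((j : nat)%:Z - ((n : nat)%:Z - 1))%R.

Definition primitives (F : finFieldType) : {set F} :=
  [set g : F | (#|F|.-1).-primitive_root g].

(* Golomb Costas permutation pi_{g1,g2} of {1,...,q-2}:
   pi(x) = y iff g1^x + g2^y = 1 (x, y in {1..q-2}, ordinal i <-> i+1). *)
Definition golomb (F : finFieldType) (g1 g2 : F) : map_n (#|F| - 2) :=
  [ffun x : 'I_(#|F| - 2) =>
     odflt x [pick y : 'I_(#|F| - 2) | (g1 ^+ x.+1 + g2 ^+ y.+1 == 1)%R]].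

Definition golomb_family (F : finFieldType) : {set map_n (#|F| - 2)} :=
  [set golomb g1 g2 | g1 in primitives F, g2 in primitives F].

Definition prime_power (q : nat) : Prop :=
  exists p k, prime p /\ (0 < k)%N /\ q = (p ^ k)%N.

Definition safe_prime_power (q : nat) : Prop :=
  prime_power q /\
  ((odd q /\ prime (q.-1./2)) \/ (~~ odd q /\ prime q.-1)).

(* Main.v *)
(* Fix a primitive element g and a small l prime to q - 1 and to the
   characteristic (l = 3, or l = 5 in characteristic 3), and take the
   permutations golomb g1 (g ^ (l ^ i)) with g1 primitive and l ^ i <= q ^ delta.
   For two of them, possibly exchanged, h1 = g1 ^ r and h2 = g2 ^ s with
   s = l ^ (j - i), and the cross-correlation is at most the number of x != 0
   with a x ^ r + be (1 - x) ^ s = 1.  By Thue's lemma r t is congruent to c - b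
   modulo q - 1 for some 0 < t and b, c, t = O(sqrt q), so the substitution
   x = g z ^ t turns the equation into a polynomial one in z of degree
   O(sqrt q * s).  The polynomial is nonzero: for s > 1 the binomial (1 - g z ^ t) ^ s
   has terms in z ^ t and z ^ (t s) which a single monomial cannot both cancel,
   and for s = 1 a cancellation forces r t = t modulo q - 1, hence r = 1 because
   q is a safe prime power. *)
Require Import Defs.
From mathcomp Require Import all_boot all_order all_algebra all_field.
From mathcomp Require Import cyclic zify ring.
Set Implicit Arguments. Unset Strict Implicit. Unset Printing Implicit Defensive.
Import GRing.Theory.
Open Scope ring_scope.

(** * Counting solutions of the curve equation by roots of polynomials *)

Lemma coef_exp1BX (R : comNzRingType) (g : R) (s i : nat) :
  ((1 - g *: 'X) ^+ s)`_i = (- g) ^+ i *+ 'C(s, i).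
Proof.
have -> : (1 - g *: 'X) ^+ s =
    \sum_(j < s.+1) ((- g) ^+ j *+ 'C(s, j)) *: 'X^j.
  rewrite exprDn; apply: eq_bigr => j _.
  by rewrite expr1n mul1r -scaleNr exprZn -scaler_nat scalerA mulr_natl.
rewrite -(poly_def s.+1 (fun j => (- g) ^+ j *+ 'C(s, j))) coef_poly.
by case: ltnP => // lt_s_i; rewrite bin_small.
Qed.

Lemma card_root_leq (F : finFieldType) (A : {set F}) (p : {poly F}) :
  p != 0 -> {in A, forall x, root p x} -> (#|A| < size p)%N.
Proof.
move=> p_neq0 rootA; rewrite cardE; apply: max_poly_roots p_neq0 _ (enum_uniq _).
by apply/allP=> x; rewrite mem_enum; apply: rootA.
Qed.

(* [z ^+ b] times the equation [a' * x ^+ r + be * (1 - x) ^+ s = 1] at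
   [x = g * z ^+ t], where [a = a' * g ^+ r] and [z ^+ (r * t + b) = z ^+ c]. *)
Definition curve_poly (F : fieldType) (a be g : F) (s t b c : nat) : {poly F} :=
  a *: 'X^c + 'X^b * (be *: ((1 - g *: 'X) ^+ s \Po 'X^t) - 1).

Lemma curve_poly_neq0 (F : fieldType) (a be g : F) (s t b c : nat) :
  be != 0 -> g != 0 -> (0 < t)%N -> s%:R != 0 :> F ->
  (c != b + t)%N || (1 < s)%N -> curve_poly a be g s t b c != 0.
Proof.
move=> be0 g0 t_gt0 s0 cs; apply/eqP=> P0.
have s_gt0 : (0 < s)%N by case: (s) s0; rewrite ?eqxx.
(* Restricting to [i > 0] avoids position [b], the only one where the term [- 1] contributes. *)
have coefP i : (0 < i)%N -> a *+ (c == b + t * i)%N =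
    - (be * ((- g) ^+ i *+ 'C(s, i))).
  move=> i_gt0; have := congr1 (fun p : {poly F} => p`_(b + t * i)) P0.
  rewrite /curve_poly coefD coefZ coefXn coefXnM ltnNge leq_addr addKn coefB coefZ.
  rewrite coef_comp_poly_Xn // dvdn_mulr // mulKn // coef_exp1BX coef1 muln_eq0.
  rewrite (gtn_eqF t_gt0) (gtn_eqF i_gt0) /= subr0 coef0 mulr_natr eq_sym => /eqP.
  by rewrite addr_eq0 => /eqP.
(* The monomial [a *: 'X^c] misses [b + t * s] or [b + t]. *)
have [c_bt | c_bt] := eqVneq c (b + t)%N.
  have s_gt1 : (1 < s)%N by move: cs; rewrite c_bt eqxx.
  have /eqP := coefP _ s_gt0; rewrite binn c_bt eqn_add2l.
  have -> : (t == t * s)%N = false by apply/eqP; nia.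
  by rewrite eq_sym oppr_eq0 mulr1n mulf_eq0 expf_eq0 oppr_eq0 (negPf be0) (negPf g0) andbF.
have /eqP := coefP _ (ltnSn 0); rewrite muln1 (negPf c_bt) bin1 expr1 mulr0n.
by rewrite eq_sym oppr_eq0 -mulr_natr !mulf_eq0 oppr_eq0 (negPf be0) (negPf g0) (negPf s0).
Qed.

Lemma size_curve_poly (F : fieldType) (a be g : F) (s t b c : nat) :
  (size (curve_poly a be g s t b c) <= (maxn c (b + t * s)).+1)%N.
Proof.
have size_inner : (size (be *: ((1 - g *: 'X) ^+ s \Po 'X^t) - 1)%R <= (t * s).+1)%N.
  apply: leq_trans (size_polyD _ _) _; rewrite size_polyN size_poly1 geq_max andbT.
  apply: leq_trans (size_scale_leq _ _) _.
  apply: leq_trans (size_comp_poly_leq _ _) _; rewrite size_polyXn ltnS mulnC leq_mul2l.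
  apply/orP; right; rewrite -subn1 leq_subLR add1n.
  apply: leq_trans (size_poly_exp_leq _ _) _; rewrite ?ltnS.
  rewrite -[leqRHS]mul1n leq_mul2r; apply/orP; right.
  rewrite -subn1 leq_subLR addn1; apply: leq_trans (size_polyD _ _) _.
  rewrite size_poly1 size_polyN geq_max /=.
  by apply: leq_trans (size_scale_leq _ _) _; rewrite size_polyX.
apply: leq_trans (size_polyD _ _) _; rewrite geq_max; apply/andP; split.
  by apply: leq_trans (size_scale_leq _ _) _; rewrite size_polyXn ltnS leq_maxl.
apply: leq_trans (size_polyMleq _ _) _; rewrite size_polyXn addSn /=.
apply: leq_trans (leq_add (leqnn b) size_inner) _.
by rewrite addnS ltnS leq_maxr.
Qed.

Definition curve_sols (F : finFieldType) (a be : F) (r s : nat) : {set F} :=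
  [set x | (x != 0) && (a * x ^+ r + be * (1 - x) ^+ s == 1)].

(* Averaging over the cosets [x = g * z ^+ t]: for every [z != 0] exactly
   [#|S|] values of [g] put [x] into the solution set [S], while for every
   [g != 0] the admissible [z] are roots of [curve_poly]. *)
Lemma card_curve_sols (F : finFieldType) (a be : F) (r s t b c : nat) :
  be != 0 -> (0 < t)%N -> s%:R != 0 :> F -> (c != b + t)%N || (1 < s)%N ->
  (forall z : F, z != 0 -> z ^+ (r * t + b) = z ^+ c) ->
  (#|curve_sols a be r s| <= maxn c (b + t * s))%N.
Proof.
move=> be0 t_gt0 s0 cs thue; set S := curve_sols _ _ _ _; set D := maxn _ _.
pose U := [set x : F | x != 0].
have U_gt0 : (0 < #|U|)%N by apply/card_gt0P; exists 1; rewrite inE oner_eq0.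
rewrite -(leq_pmul2l U_gt0) -sum_nat_const -[leqRHS]sum_nat_const.
have fiber_z z : z \in U -> #|S| = (\sum_(g in U) ((g * z ^+ t)%R \in S))%N.
  rewrite inE => z0; have zt0 : z ^+ t != 0 by rewrite expf_neq0.
  rewrite -sum1_card big_mkcond [RHS]big_mkcond /=.
  rewrite (reindex_onto (fun g => g * z ^+ t) (fun x => x / z ^+ t)) /=; last first.
    by move=> x _; rewrite divfK.
  apply: eq_big => [g | g _]; first by rewrite mulfK ?eqxx.
  (* The value [g = 0] contributes nothing, since [curve_sols] excludes [x = 0]. *)
  rewrite [g \in U]inE; case: (eqVneq g 0) => [-> |] /=; last by case: (_ \in S).
  by rewrite mul0r !inE eqxx.
rewrite (eq_bigr _ fiber_z) exchange_big; apply: leq_sum => g; rewrite inE => g0.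
rewrite -big_mkcondr sum1dep_card.
have := @card_root_leq F [set z | (z \in U) && (g * z ^+ t \in S)] _
  (@curve_poly_neq0 _ (a * g ^+ r) be g s t b c be0 g0 t_gt0 s0 cs).
move=> rootP; rewrite -ltnS; apply: leq_trans (rootP _) (size_curve_poly _ _ _ _ _ _ _).
move=> z; rewrite !inE => /and3P[z0 _ /eqP Ez].
rewrite /root /curve_poly; rewrite !hornerE horner_comp !hornerE.
apply/eqP; rewrite -thue // exprD mulnC exprM; rewrite exprMn in Ez.
have -> : a * g ^+ r * (z ^+ t ^+ r * z ^+ b) = z ^+ b * (a * (g ^+ r * z ^+ t ^+ r)) by ring.
by rewrite -mulrDr addrA Ez subrr mulr0.
Qed.

(** * Congruences modulo q - 1 *)

(** Pigeonhole: the [T.+1 * T.+1] pairs [(i, j)] outnumber the residues, so two values of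
    [r * i + j] collide. Keeping the two second coordinates as [b] and [c] on opposite sides avoids
    negative numbers. *)
Lemma thue (n r T : nat) : (T < n)%N -> (n < T.+1 * T.+1)%N ->
  exists t b c, [/\ (0 < t <= T)%N, (b <= T)%N, (c <= T)%N
                  & r * t + b = c %[mod n]].
Proof.
move=> lt_T_n lt_n_T2; have n_gt0 : (0 < n)%N by apply: leq_ltn_trans lt_T_n.
pose f (ij : 'I_T.+1 * 'I_T.+1) : 'I_n := Ordinal (ltn_pmod (r * ij.1 + ij.2) n_gt0).
have /injectivePn[[i j] [[i' j'] ne_ij [Ef]]] : ~~ injectiveb f.
  apply/injectiveP=> /leq_card; rewrite card_prod !card_ord.
  by rewrite leqNgt lt_n_T2.
have {f} [ltT_i ltT_j ltT_i' ltT_j'] := And4 (ltn_ord i) (ltn_ord j) (ltn_ord i') (ltn_ord j').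
(* Equal first coordinates would force equal second ones, as these are at most [T < n]. *)
have ne_i : i != i' :> nat.
  apply: contraNneq ne_ij => Ei; move/eqP: Ef; rewrite /= Ei eqn_modDl => /eqP.
  by rewrite !modn_small ?(leq_trans _ lt_T_n) // => Ej; apply/eqP; congr pair; apply: val_inj.
wlog lt_i : i j i' j' {ne_ij} ltT_i ltT_j ltT_i' ltT_j' ne_i Ef / (i' < i)%N => [wlog_i|].
  have [lt_ii|lt_ii|Ei] := ltngtP i' i; first by apply: (wlog_i i j i' j').
    by apply: (wlog_i i' j' i j) => //; rewrite eq_sym.
  by rewrite Ei eqxx in ne_i.
exists (i - i')%N, j, j'; split; try lia.
apply/eqP; rewrite -(eqn_modDl (r * i')) addnA -mulnDr subnKC; last exact: ltnW.
by rewrite Ef.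
Qed.

(** Here safety of q enters. Since [n] divides [(r - 1) * t] and [p] is too large to divide [t], it
    divides [r - 1]; if [n = 2 * p], then [r] is odd by coprimality, so 2 divides [r - 1] as
    well. *)
Lemma eq1_mod_of_mul_fix (p n r t : nat) : prime p -> (2 < p)%N ->
  n = p \/ n = (2 * p)%N -> coprime r n -> (0 < t < p)%N ->
  r * t = t %[mod n] -> r = 1 %[mod n].
Proof.
move=> p_pr p_gt2 nE co_rn /andP[t_gt0 lt_tp] /eqP.
have [r0 | r_gt0] := posnP r.
  by move: co_rn; rewrite r0 /coprime gcd0n => /eqP n1; case: nE; lia.
rewrite -[X in _ == X %[mod _]]mul1n eqn_mod_dvd ?leq_mul2r ?r_gt0 ?orbT // -mulnBl => n_dvd.
have p_dvd_n : (p %| n)%N by case: nE => ->; rewrite ?dvdn_mull.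
have p_dvd : (p %| r - 1)%N.
  have := dvdn_trans p_dvd_n n_dvd; rewrite Euclid_dvdM // => /orP[] //.
  by move/(dvdn_leq t_gt0); lia.
apply/eqP; rewrite eqn_mod_dvd //; case: nE => [-> // | nE]; rewrite nE Gauss_dvd.
  rewrite p_dvd andbT dvdn2 oddB // addbT negbK.
  by move: co_rn; rewrite nE coprimeMr coprimen2 => /andP[].
by rewrite coprime2n; have [p2|] := even_prime p_pr; first by rewrite p2 in p_gt2.
Qed.

(** * Primitive elements of a finite field *)

Lemma in_primitives (F : finFieldType) (g : F) :
  (g \in primitives F) = (#|F|.-1).-primitive_root g.
Proof. by rewrite inE. Qed.

Lemma finField_card_gt1 (F : finFieldType) : (1 < #|F|)%N.
Proof.
by have := subset_leq_card (subsetT [set 0; 1 : F]); rewrite cards2 eq_sym oner_neq0 cardsT.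
Qed.

Lemma expf_card_pred (F : finFieldType) (x : F) : x != 0 -> x ^+ #|F|.-1 = 1.
Proof.
move=> x0; apply: (mulfI x0); rewrite mulr1 -exprS prednK ?expf_card //.
exact: ltnW (finField_card_gt1 F).
Qed.

Lemma expf_mod (F : finFieldType) (x : F) (i j : nat) :
  x != 0 -> i = j %[mod #|F|.-1] -> x ^+ i = x ^+ j.
Proof.
move=> x0 Eij; rewrite (divn_eq i #|F|.-1) (divn_eq j #|F|.-1) Eij !exprD.
by rewrite ![(_ * #|F|.-1)%N]mulnC !exprM expf_card_pred // !expr1n.
Qed.

Lemma primitive_neq0 (F : finFieldType) (g : F) : g \in primitives F -> g != 0.
Proof.
rewrite in_primitives => g_pr; apply/eqP=> g0; have := prim_expr_order g_pr.
rewrite g0 expr0n; have := finField_card_gt1 F; case: (#|F|) => [|[|m]] //= _ /eqP.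
by rewrite eq_sym oner_eq0.
Qed.

Lemma primitives_neq0 (F : finFieldType) : exists g : F, g \in primitives F.
Proof.
have q_gt1 := finField_card_gt1 F.
have := @has_prim_root F #|F|.-1 (enum [set x : F | x != 0]).
have cardU : #|[set x : F | x != 0]| = #|F|.-1.
  have -> : [set x : F | x != 0] = [set~ 0] by apply/setP=> x; rewrite !inE.
  by rewrite cardsC1.
case/(_ _ _ _ _)/hasP; rewrite ?enum_uniq -?cardE ?cardU //; first by lia.
  apply/allP=> x; rewrite mem_enum inE => x0.
  by apply/unity_rootP; apply: expf_card_pred.
by move=> g _ g_pr; exists g; rewrite in_primitives.
Qed.

Lemma primitive_expP (F : finFieldType) (g h : F) :
  g \in primitives F -> h \in primitives F ->
  exists r, [/\ (r < #|F|.-1)%N, coprime r #|F|.-1 & h = g ^+ r].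
Proof.
rewrite !in_primitives => g_pr h_pr.
have [r Eh] := prim_rootP g_pr (prim_expr_order h_pr).
by exists r; split=> //; rewrite -(prim_root_exp_coprime r g_pr) -Eh.
Qed.

Lemma card_primitives (F : finFieldType) : (totient #|F|.-1 <= #|primitives F|)%N.
Proof.
have [g] := primitives_neq0 F; rewrite in_primitives => g_pr.
rewrite totient_count_coprime big_mkord -big_mkcond sum1dep_card.
rewrite -(@card_in_imset _ _ (fun i : 'I_#|F|.-1 => g ^+ i)) => [|i j _ _ /eqP].
  apply/subset_leq_card/subsetP=> w /imsetP[i]; rewrite inE => co_i ->.
  by rewrite in_primitives prim_root_exp_coprime // coprime_sym.
by rewrite (eq_prim_root_expr g_pr) !modn_small // => /eqP/val_inj.
Qed.

(** * Golomb permutations and their cross-correlation *)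

(** The default in [golomb] is never taken: [1 - g1 ^+ x.+1] is nonzero because [0 < x.+1 < q - 1],
    so it is a power of [g2], and the exponent is not 0 because [g1 ^+ x.+1] is nonzero. *)
Lemma golombP (F : finFieldType) (g1 g2 : F) (x : 'I_(#|F| - 2)) :
  g1 \in primitives F -> g2 \in primitives F ->
  g1 ^+ x.+1 + g2 ^+ (golomb g1 g2 x).+1 = 1.
Proof.
move=> g1P g2P; rewrite ffunE; case: pickP => [y /eqP // | noy].
have g1_pr := g1P; rewrite in_primitives in g1_pr.
have x_lt := ltn_ord x.
have y0 : 1 - g1 ^+ x.+1 != 0.
  rewrite subr_eq0 eq_sym -(expr0 g1) (eq_prim_root_expr g1_pr) mod0n modn_small //; lia.
have [[y y_lt] /= Ey] : {i : 'I_#|F|.-1 | 1 - g1 ^+ x.+1 = g2 ^+ i}.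
  by apply: prim_rootP (expf_card_pred y0); rewrite -in_primitives.
case: y y_lt Ey => [|y] y_lt Ey.
  move/eqP: Ey; rewrite expr0 subr_eq addrC -subr_eq subrr eq_sym expf_eq0.
  by rewrite (negPf (primitive_neq0 g1P)) andbF.
have y_lt2 : (y < #|F| - 2)%N by lia.
by have /eqP[] := noy (Ordinal y_lt2); rewrite /= -Ey addrC subrK.
Qed.

(** A coincidence at [x], with [y = x + u], yields the solution [X = g1 ^+ x.+1]: the two terms of
    the equation become [h1 ^+ y.+1] and [h2 ^+ (golomb h1 h2 y).+1], whose sum is 1. Integer powers
    absorb the shifts, which may be negative. *)
Lemma ccorr_leq_curve_sols (F : finFieldType) (g1 g2 h1 h2 : F) (r s : nat) (u v : int) :
  g1 \in primitives F -> g2 \in primitives F ->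
  h1 \in primitives F -> h2 \in primitives F ->
  h1 = g1 ^+ r -> h2 = g2 ^+ s ->
  (ccorr (golomb g1 g2) (golomb h1 h2) u v <= #|curve_sols (h1 ^ u)%R (h2 ^ v)%R r s|)%N.
Proof.
move=> g1P g2P h1P h2P Eh1 Eh2; have g1_pr := g1P; rewrite in_primitives in g1_pr.
rewrite /ccorr; set A := [set x | _].
rewrite -(@card_in_imset _ _ (fun x : 'I__ => g1 ^+ x.+1) A) => [|x y _ _ /eqP].
  apply/subset_leq_card/subsetP=> w /imsetP[x]; rewrite inE => /existsP[y].
  case/andP=> /eqP Exy /eqP Ef ->; rewrite inE expf_neq0 ?primitive_neq0 //=.
  have -> : 1 - g1 ^+ x.+1 = g2 ^+ (golomb g1 g2 x).+1.
    by rewrite -[X in X - _](golombP x g1P g2P) addrAC subrr add0r.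
  rewrite -exprM mulnC exprM -Eh1 -[(g2 ^+ _) ^+ s]exprM mulnC exprM -Eh2.
  apply/eqP; rewrite -[RHS](golombP y h1P h2P); congr (_ + _).
    rewrite !exprnP -expfzDr ?primitive_neq0 //; congr (h1 ^ _); rewrite !intS Exy; ring.
  rewrite !exprnP -expfzDr ?primitive_neq0 //; congr (h2 ^ _); rewrite !intS -Ef; ring.
rewrite (eq_prim_root_expr g1_pr) !modn_small => [/eqP[]||]; first exact: val_inj.
  by have := ltn_ord y; lia.
by have := ltn_ord x; lia.
Qed.

(** The translation by [u] carries coincidences of one pair injectively to those of the exchanged
    pair. This allows ordering two permutations by their exponents of [l]. *)
Lemma ccorr_sym_leq n (f1 f2 : map_n n) (u v : int) :
  (ccorr f1 f2 u v <= ccorr f2 f1 (- u) (- v))%N.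
Proof.
rewrite /ccorr; set A := [set x | _]; set B := [set x | _].
pose f (x : 'I_n) : 'I_n := odflt x [pick y : 'I_n | (y : nat)%:Z == (x : nat)%:Z + u].
have fP x : x \in A -> (f x : nat)%:Z = (x : nat)%:Z + u
                     /\ (f1 x : nat)%:Z + v = (f2 (f x) : nat)%:Z.
  rewrite inE => /existsP[y /andP[/eqP Ey /eqP Ef]].
  have -> : f x = y; last by [].
  rewrite /f; case: pickP => [z /eqP Ez | /(_ y)]; last by rewrite Ey eqxx.
  by apply/val_inj; move: Ez; rewrite -Ey => -[].
rewrite -(@card_in_imset _ _ f A) => [|x y /fP[Ex _] /fP[Ey _] Exy].
  apply/subset_leq_card/subsetP=> _ /imsetP[x /fP[Ex Ef] ->].
  rewrite inE; apply/existsP; exists x; rewrite Ex -Ef.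
  by apply/andP; split; apply/eqP; lia.
by apply: val_inj => /=; move: Ex Ey; rewrite Exy; lia.
Qed.

Lemma ccorr_golomb_leq (F : finFieldType) (g1 g2 h1 : F) (p s T : nat) (u v : int) :
  prime p -> (2 < p)%N -> #|F|.-1 = p \/ #|F|.-1 = (2 * p)%N ->
  (T < p)%N -> (#|F| <= T.+1 * T.+1)%N ->
  g1 \in primitives F -> g2 \in primitives F ->
  h1 \in primitives F -> g2 ^+ s \in primitives F ->
  s%:R != 0 :> F -> (h1 != g1) || (1 < s)%N ->
  (ccorr (golomb g1 g2) (golomb h1 (g2 ^+ s)) u v <= T + T * s)%N.
Proof.
move=> p_pr p_gt2 nE lt_Tp le_qT g1P g2P h1P h2P s0 ne.
have q_gt1 := finField_card_gt1 F.
have [r [_ co_rn Eh1]] := primitive_expP g1P h1P.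
have [||t [b [c [/andP[t_gt0 le_tT] le_bT le_cT Etbc]]]] := @thue #|F|.-1 r T; try lia.
apply: leq_trans (ccorr_leq_curve_sols u v g1P g2P h1P h2P Eh1 erefl) _.
apply: leq_trans (@card_curve_sols _ _ _ r s t b c _ t_gt0 s0 _ _) _.
- by rewrite expfz_neq0 ?primitive_neq0.
- case/orP: ne => [ne|->]; last by rewrite orbT.
  (* If [c = b + t], the congruence reduces to [r * t = t], hence [r = 1] modulo q - 1 and
     [h1 = g1]. *)
  apply/orP; left; apply: contraNneq ne => Ec; rewrite Eh1; apply/eqP.
  rewrite -[RHS]expr1; apply: expf_mod; first exact: primitive_neq0.
  apply: (eq1_mod_of_mul_fix (t := t) p_pr p_gt2 nE co_rn).
    by rewrite t_gt0 (leq_ltn_trans le_tT).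
  by apply/eqP; rewrite -(eqn_modDr b) Etbc Ec addnC.
- by move=> z z0; apply: expf_mod.
by rewrite geq_max; nia.
Qed.

(* Equal permutations would make every [x != 0] a solution of the curve equation
   with [t = 1], more than its degree allows. *)
Lemma golomb_eq_exp (F : finFieldType) (g1 g2 h1 : F) (s : nat) :
  g1 \in primitives F -> g2 \in primitives F ->
  h1 \in primitives F -> g2 ^+ s \in primitives F ->
  (s < #|F|.-1)%N -> s%:R != 0 :> F ->
  golomb g1 g2 = golomb h1 (g2 ^+ s) -> h1 = g1 /\ (s <= 1)%N.
Proof.
move=> g1P g2P h1P h2P lt_s s0 Eg.
have s_gt0 : (0 < s)%N by case: (s) s0; rewrite ?eqxx.
have g1_pr := g1P; rewrite in_primitives in g1_pr.
have [r [lt_r _ Eh1]] := primitive_expP g1P h1P.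
suff: (h1 == g1) && (s <= 1)%N by case/andP=> /eqP.
apply: contraT; rewrite negb_and -ltnNge => ne.
have sub : [set~ (0 : F)] \subset curve_sols 1 1 r s.
  apply/subsetP=> x; rewrite !inE => x0; rewrite x0 !mul1r /=.
  have [[i lt_i] /= ->] := prim_rootP g1_pr (expf_card_pred x0).
  (* The point [x = 1] corresponds to no argument of the permutations and is checked directly. *)
  case: i lt_i => [_|i lt_i].
    by rewrite expr0 subrr expr1n expr0n gtn_eqF // addr0.
  have lt_i2 : (i < #|F| - 2)%N by lia.
  have := golombP (Ordinal lt_i2) g1P g2P; rewrite addrC => /(canRL (addrK _)) /= <-.
  rewrite -exprM mulnC exprM -Eh1 -exprM mulnC exprM Eg.
  by apply/eqP; rewrite -[RHS](golombP (Ordinal lt_i2) h1P h2P).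
have := subset_leq_card sub; rewrite leqNgt cardsC1 => /negP[]; apply: leq_ltn_trans (_ : maxn r (0 + 1 * s) < _)%N.
  apply: card_curve_sols => //; first exact: oner_neq0.
    case/orP: ne => [ne|->]; last by rewrite orbT.
    by apply/orP; left; apply: contraNneq ne => Er; rewrite Eh1 Er expr1.
  by move=> z _; rewrite muln1 addn0.
by rewrite gtn_max lt_r add0n mul1n.
Qed.

(** * The subfamily for given parameters *)

Lemma golomb_subfamily (F : finFieldType) (p l K T : nat) :
  prime p -> (2 < p)%N -> #|F|.-1 = p \/ #|F|.-1 = (2 * p)%N ->
  (T < p)%N -> (#|F| <= T.+1 * T.+1)%N ->
  (1 < l)%N -> coprime l #|F|.-1 -> l%:R != 0 :> F -> (l ^ K < #|F|.-1)%N ->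
  exists L : {set map_n (#|F| - 2)},
    [/\ L \subset golomb_family F, (totient #|F|.-1 * K.+1 <= #|L|)%N
      & (maxcc L <= T + T * l ^ K)%N].
Proof.
move=> p_pr p_gt2 nE lt_Tp le_qT l_gt1 co_l l0 lt_lK.
have [g gP] := primitives_neq0 F; have g_pr := gP; rewrite in_primitives in g_pr.
pose b i := g ^+ (l ^ i).
have bP i : b i \in primitives F by rewrite in_primitives prim_root_exp_coprime // coprimeXl.
(* Powers of [l] form a divisibility chain, so of any two second generators one is a power of the
   other, with exponent at most [l ^ K]. *)
have bD i j : (i <= j)%N -> b j = b i ^+ (l ^ (j - i)).
  by move=> le_ij; rewrite /b -exprM -expnD subnKC.
have lX0 i : (l ^ i)%:R != 0 :> F by rewrite natrX expf_neq0.
have le_lX i (j : 'I_K.+1) : (l ^ (j - i) <= l ^ K)%N.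
  by rewrite leq_exp2l //; have := ltn_ord j; lia.
pose f (x : F * 'I_K.+1) := golomb x.1 (b x.2).
pose D := setX (primitives F) [set: 'I_K.+1].
have D1 x : x \in D -> x.1 \in primitives F by rewrite inE => /andP[].
have inj_f : {in D &, injective f}.
  move=> x y xD yD; wlog le_xy : x y xD yD / (x.2 <= y.2)%N => [wlog_xy|].
    by case/orP: (leq_total x.2 y.2) => ? ?; [|symmetry]; apply: wlog_xy.
  rewrite /f (bD _ _ le_xy) => /golomb_eq_exp[]; rewrite ?D1 -?bD //.
    by apply: leq_ltn_trans lt_lK.
  move=> E1; rewrite -(expn0 l) leq_exp2l // => le0.
  by case: x y le_xy E1 le0 {xD yD} => [x1 x2] [y1 y2] /= ? -> ?; congr pair; apply: val_inj => /=; lia.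
have ccorr_le x y u v : x \in D -> y \in D -> (x.2 <= y.2)%N -> f x != f y ->
    (ccorr (f x) (f y) u v <= T + T * l ^ K)%N.
  move=> xD yD le_xy ne; rewrite /f (bD _ _ le_xy).
  apply: leq_trans (@ccorr_golomb_leq F _ _ _ p _ T u v _ _ _ _ _ _ _ _ _ _ _) _;
    rewrite -?bD ?D1 ?leq_add2l ?leq_mul ?le_lX //.
  apply: contraNT ne; rewrite negb_or negbK -leqNgt => /andP[/eqP E1].
  rewrite -[X in (_ <= X)%N](expn0 l) leq_exp2l // => le0.
  case: x y le_xy E1 le0 {xD yD} => [x1 x2] [y1 y2] /= ? -> ?.
  by apply/eqP; congr f; congr pair; apply: val_inj => /=; lia.
exists (f @: D); split.
- apply/subsetP=> _ /imsetP[x xD ->]; apply/imset2P.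
  by exists x.1 (b x.2) => //; apply: D1.
- by rewrite card_in_imset // cardsX cardsT card_ord leq_mul2r card_primitives orbT.
apply/bigmax_leqP=> _ /imsetP[x xD ->].
apply/bigmax_leqP=> _ /andP[/imsetP[y yD ->] ne].
apply/bigmax_leqP=> i _; apply/bigmax_leqP=> j _.
have [le_xy|/ltnW le_yx] := leqP x.2 y.2; first by apply: ccorr_le => //; rewrite eq_sym.
by apply: leq_trans (ccorr_sym_leq _ _ _ _) _; apply: ccorr_le.
Qed.

(** * Arithmetic of safe prime powers and choice of [l] and [T] *)

Lemma safe_prime_powerP (F : finFieldType) :
  safe_prime_power #|F| -> (7 < #|F|)%N ->
  exists p, [/\ prime p, (4 < p)%N, #|F|.-1 = p \/ #|F|.-1 = (2 * p)%N
              & (#|F| <= 4 * totient #|F|.-1)%N].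
Proof.
case=> _ [[q_odd p_pr]|[_ p_pr]] q_gt7.
  have nE : #|F|.-1 = (2 * #|F|.-1./2)%N by have := odd_double_half #|F|.-1; lia.
  exists #|F|.-1./2; split; [by []| |by right|].
    (* An odd q > 7 only gives a half of at least 4, and 4 is not prime. *)
    have : #|F|.-1./2 != 4%N by apply: contraTneq p_pr => ->.
    by lia.
  rewrite nE totient_coprime ?totient_prime //; last first.
    by rewrite coprime2n; have [p2|] := even_prime p_pr; first by lia.
  by lia.
exists #|F|.-1; split; [by []| by lia |by left|].
by rewrite totient_prime //; lia.
Qed.

(** The choice [l = 3] works outside characteristic 3, and [l = 5] in it. There [p = 5] would force
    q = 11, a field of characteristic 11. Invertibility of [l] in the field keeps the linear
    coefficient of the binomial nonzero. *)
Lemma coprime_base_exists (F : finFieldType) (p : nat) :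
  (7 < #|F|)%N -> prime p -> (4 < p)%N -> #|F|.-1 = p \/ #|F|.-1 = (2 * p)%N ->
  exists l, [/\ (1 < l <= 5)%N, coprime l #|F|.-1 & l%:R != 0 :> F].
Proof.
move=> q_gt7 p_pr p_gt4 nE.
have co_l l : prime l -> odd l -> l != p -> coprime l #|F|.-1.
  move=> l_pr l_odd ne_lp; have co_lp : coprime l p by rewrite prime_coprime // dvdn_prime2.
  by case: nE => ->; rewrite ?coprimeMr ?coprimen2 ?l_odd.
have [F3|F3] := eqVneq (3%:R : F) 0; last first.
  by exists 3; split=> //; apply: co_l => //; lia.
exists 5; split=> //.
  apply: co_l => //; apply/eqP=> p5; rewrite -p5 in nE.
  have q11 : #|F| = 11 by lia.
  have /andP[_ /eqP F11] : 11 \in [pchar F] by apply: (@card_finPcharP _ _ 1).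
  have : (1 : F) = 3%:R *+ 4 - 11%:R by ring.
  by rewrite F11 F3 mul0rn subr0 => /eqP; rewrite oner_eq0.
apply/eqP=> F5; have : (1 : F) = 3%:R *+ 2 - 5%:R by ring.
by rewrite F5 F3 mul0rn subr0 => /eqP; rewrite oner_eq0.
Qed.

(** The lower bound puts [T] below the square root of q, and the upper bound supplies enough pairs
    for [thue]. *)
Lemma sqrt_bracket (q : nat) : (0 < q)%N ->
  exists T, (T * T < q)%N && (q <= T.+1 * T.+1)%N.
Proof.
move=> q_gt0; have ex0 : exists T, (T * T < q)%N by exists 0.
have ub T : (T * T < q)%N -> (T <= q)%N by nia.
case: (ex_maxnP ex0 ub) => T ltT maxT; exists T; rewrite ltT leqNgt.
by apply/negP=> /maxT; rewrite ltnn.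
Qed.

Close Scope ring_scope.
From Stdlib Require Import Reals Lra.

(** * Real estimates and the final choice of parameters *)

Lemma INR_floor_exists (x : R) : (0 <= x)%R -> exists K, (INR K <= x < INR K + 1)%R.
Proof.
move=> x_ge0; have [up_gt up_le] := archimed x.
have up_ge1 : (0 < up x)%Z by apply: lt_IZR; lra.
exists (Z.to_nat (up x - 1)).
rewrite INR_IZR_INZ Znat.Z2Nat.id; last by lia.
by rewrite minus_IZR; lra.
Qed.

Lemma INR_expn (m k : nat) : INR (expn m k) = (INR m ^ k)%R.
Proof. by elim: k => // k IHk; rewrite expnS mult_INR IHk. Qed.

Lemma Rpower_half_sqr (x : R) : (0 < x)%R -> (Rpower x (1 / 2) * Rpower x (1 / 2) = x)%R.
Proof. by move=> x0; rewrite -Rpower_plus (_ : 1 / 2 + 1 / 2 = 1)%R ?Rpower_1 //; lra. Qed.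

Lemma INR_le_Rpower_half (m q : nat) : (0 < q)%N -> (m * m <= q)%N ->
  (INR m <= Rpower (INR q) (1 / 2))%R.
Proof.
move=> /ltP/lt_0_INR q0 /leP/le_INR; rewrite mult_INR -[X in (_ <= X)%R -> _](Rpower_half_sqr q0).
have s0 : (0 < Rpower (INR q) (1 / 2))%R by apply: exp_pos.
move=> le_ms; apply: Rnot_lt_le => lt_sm; nra.
Qed.

Lemma sqr_le_of_Rpower_half (m q : nat) : (0 < q)%N ->
  (INR m <= Rpower (INR q) (1 / 2))%R -> (m * m <= q)%N.
Proof.
move=> /ltP/lt_0_INR q0 le_m; apply/leP/INR_le; rewrite mult_INR -[X in (_ <= X)%R](Rpower_half_sqr q0).
by have := pos_INR m; nra.
Qed.

Theorem theorem1 :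
  exists c1 c2 : R, (0 < c1)%R /\ (0 < c2)%R /\
  forall (F : finFieldType) (delta : R),
    safe_prime_power #|F| -> (7 < #|F|)%N ->
    (0 < delta)%R -> (delta < 1 / 2)%R ->
    exists L : {set map_n (#|F| - 2)},
      L \subset golomb_family F /\
      (delta * INR #|F| * ln (INR #|F|) <= c1 * INR #|L|)%R /\
      (INR (maxcc L) <= c2 * Rpower (INR #|F|) (1 / 2 + delta))%R.
Proof.
have ln5 : (0 < ln 5)%R by rewrite -ln_1; apply: ln_increasing; lra.
(* The 4 comes from [totient (q - 1) >= q / 4], the [ln 5] from [l <= 5], and the 2 from
   [T + T * l ^ K <= 2 * T * l ^ K]. *)
exists (4 * ln 5)%R, 2%R; split; [lra | split; [lra |]].
move=> F delta safeF q_gt7 d_gt0 d_lt.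
have [p [p_pr p_gt4 nE le_tot]] := safe_prime_powerP safeF q_gt7.
have [l [/andP[l_gt1 l_le5] co_l l0]] := coprime_base_exists q_gt7 p_pr p_gt4 nE.
have q_gt0 : (0 < #|F|)%N by apply: leq_trans q_gt7.
have [T /andP[ltT leT]] := sqrt_bracket q_gt0.
set q := INR #|F|.
have q1 : (1 < q)%R by apply: (lt_INR 1); apply/ltP; apply: leq_trans q_gt7.
have lnq : (0 < ln q)%R by rewrite -ln_1; apply: ln_increasing; lra.
have l1 : (1 < INR l)%R by apply: (lt_INR 1); apply/ltP.
have l5 : (INR l <= 5)%R.
  by rewrite (_ : 5%R = INR 5); [apply: le_INR; apply/leP | rewrite /=; lra].
have lnl : (0 < ln (INR l))%R by rewrite -ln_1; apply: ln_increasing; lra.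
have lnl5 : (ln (INR l) <= ln 5)%R by case: l5 => [?|->]; [left; apply: ln_increasing | right]; lra.
(* [K] is the largest integer with [l ^ K <= q ^ delta]; its maximality makes [K + 1] at least of
   order [delta * ln q]. *)
have [|K [leK ltK]] := @INR_floor_exists (delta * ln q / ln (INR l)).
  by apply: Rlt_le; apply: Rdiv_lt_0_compat => //; nra.
have {}leK : (INR K * ln (INR l) <= delta * ln q)%R.
  have := Rmult_le_compat_r _ _ _ (Rlt_le _ _ lnl) leK.
  by rewrite /Rdiv Rmult_assoc Rinv_l; lra.
have {}ltK : (delta * ln q <= (INR K + 1) * ln (INR l))%R.
  have := Rmult_le_compat_r _ _ _ (Rlt_le _ _ lnl) (Rlt_le _ _ ltK).
  by rewrite /Rdiv Rmult_assoc Rinv_l; lra.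
have le_lK : (INR (expn l K) <= Rpower q delta)%R.
  rewrite INR_expn -Rpower_pow /Rpower; last by lra.
  have [lt|->] := Rle_lt_or_eq_dec _ _ leK; last exact: Rle_refl.
  by apply: Rlt_le; apply: exp_increasing.
(* Since [delta < 1 / 2], the square of [l ^ K] is at most q. *)
have lt_lK : (expn l K < #|F|.-1)%N.
  have : (expn l K * expn l K <= #|F|)%N.
    apply: sqr_le_of_Rpower_half => //; apply: Rle_trans le_lK _.
    by apply: Rle_Rpower; lra.
  by nia.
have lt_Tp : (T < p)%N by nia.
have [//|||||||||L [subL cardL maxL]] := @golomb_subfamily F p l K T => //; first by lia.
exists L; split=> //; split.
  have {cardL} : (INR (muln #|F| K.+1) <= INR (muln 4 #|L|))%R by apply: le_INR; apply/leP; nia.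
  rewrite !mult_INR S_INR -/q (_ : INR 4 = 4%R); last by rewrite /=; lra.
  have le_dK : (delta * ln q <= (INR K + 1) * ln 5)%R.
    by apply: Rle_trans ltK _; apply: Rmult_le_compat_l lnl5; have := pos_INR K; lra.
  move=> cardL; have := Rmult_le_compat_r _ _ _ (Rlt_le _ _ ln5) cardL.
  have := Rmult_le_compat_l q _ _ (ltac:(lra)) le_dK; lra.
have {maxL} : (INR (maxcc L) <= INR (muln 2 (muln T (expn l K))))%R.
  by apply: le_INR; apply/leP; have := expn_gt0 l K; nia.
rewrite !mult_INR Rpower_plus (_ : INR 2 = 2%R) // => maxL.
apply: Rle_trans maxL _; apply: Rmult_le_compat_l; first by lra.
apply: Rmult_le_compat => //; try exact: pos_INR.
by apply: INR_le_Rpower_half => //; apply: ltnW.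
Qed.
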